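(* Given a maximum polynomial degree $\sigma\ge 1$, the price-of-anarchy bound $\frac{k^\sigma}{1-\xi(\sigma)}$, where $\xi(\sigma)=\sigma(\sigma+1)^{-\frac{\sigma+1}{\sigma}}$ (an upper bound on the price of anarchy of all games with cost functions in $\mathcal{C}_{k,\sigma}$), is order-optimal with respect to the maximum degree of asymmetry $k$: for each fixed $\sigma$ there is a constant $a_\sigma>0$, independent of $k$, such that for every $k\ge 1$ the supremum of the price of anarchy over all nonatomic mixed-autonomy congestion games with cost functions in $\mathcal{C}_{k,\sigma}$ is at least $a_\sigma\,\frac{k^\sigma}{1-\xi(\sigma)}$.
   Context: Game: a directed network with $n$ roads (links) and $m$ origin-destination pairs; the $j$-th pair has demand $\alpha_j\ge 0$ of human-driven flow and $\beta_j\ge 0$ of autonomous flow. Drivers are nonatomic. A routing is a vector $z=(x_1,y_1,\ldots,x_n,y_n)\in\mathbb{R}_{\ge 0}^{2n}$, where $x_i,y_i$ are the human-driven and autonomous flows on road $i$; it is feasible if it routes all demand of both types from origins to destinations, respecting conservation of flow. Both vehicle types on road $i$ experience latency $c_i(x_i,y_i)$. The social cost is $C(z)=\sum_{i=1}^n c_i(x_i,y_i)(x_i+y_i)$. A (Wardrop) equilibrium is a feasible routing in which all users sharing an origin and destination use paths of equal latency and no unused path has smaller latency. A social optimum is a feasible routing minimizing $C$. The price of anarchy of a game is the ratio between the social cost of a worst-case (largest social cost) equilibrium and the social cost of a social optimum. Cost functions: the latency on road $i$ is $$c_i(x_i,y_i)=t_i\Big(1+\rho_i\Big(\tfrac{x_i+y_i}{m_i(x_i,y_i)}\Big)^{\sigma_i}\Big),\qquad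 t_i\ge 0,\ \rho_i\ge 0,\ \sigma_i\ge 1,$$ where, with $\alpha(x_i,y_i)=y_i/(x_i+y_i)$ and constants $d_i,h_i,\bar h_i>0$ (road length, nonplatooned spacing, platooned spacing; no order between $h_i$ and $\bar h_i$ is assumed), the capacity $m_i$ is given by either capacity model 1, $$m_i(x_i,y_i)=\frac{d_i}{\alpha(x_i,y_i)\bar h_i+(1-\alpha(x_i,y_i))h_i},$$ or capacity model 2, $$m_i(x_i,y_i)=\frac{d_i}{\alpha^2(x_i,y_i)\bar h_i+(1-\alpha^2(x_i,y_i))h_i}.$$ At $x_i=y_i=0$ the quotient $(x_i+y_i)/m_i(x_i,y_i)$ is taken to be $0$. The maximum degree of asymmetry is $k=\max_{i}\max(h_i/\bar h_i,\ \bar h_i/h_i)$ and the maximum polynomial degree is $\sigma=\max_i\sigma_i$ (maxima over all roads). $\mathcal{C}_{k,\sigma}$ is the class of network cost functions whose road latencies are $c_i(x_i,y_i)=t_i\big(1+\rho_i\big(\tfrac{x_i+y_i}{m_i(x_i,y_i)}\big)^{\sigma_i}\big)$ with $t_i\ge 0$, $\rho_i\ge 0$, $\sigma_i\ge 1$ and $m_i$ given by capacity model 1 or capacity model 2, with maximum degree of asymmetry $k$ and maximum polynomial degree $\sigma$. *)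

(* Defs.v *)
From HB Require Import structures.
From mathcomp Require Import all_boot all_order all_algebra.
From mathcomp Require Import all_classical all_reals all_analysis.

Set Implicit Arguments.
Unset Strict Implicit.
Unset Printing Implicit Defensive.

Import Order.TTheory GRing.Theory Num.Theory.
Local Open Scope ring_scope.

Inductive capacity_model := Model1 | Model2.

Record road_cost (R : realType) := RoadCost {
  rc_t : R;
  rc_rho : R;
  rc_sigma : R;
  rc_model : capacity_model;
  rc_d : R;     (* road length *)
  rc_h : R;     (* nonplatooned spacing *)
  rc_hbar : R;  (* platooned spacing *)
  rc_t_ge0 : 0 <= rc_t;
  rc_rho_ge0 : 0 <= rc_rho;
  rc_sigma_ge1 : 1 <= rc_sigma;
  rc_d_gt0 : 0 < rc_d;
  rc_h_gt0 : 0 < rc_h;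
  rc_hbar_gt0 : 0 < rc_hbar
}.

Definition autonomy {R : realType} (x y : R) : R := y / (x + y).

Definition capacity {R : realType} (c : road_cost R) (x y : R) : R :=
  let a := autonomy x y in
  match rc_model c with
  | Model1 => rc_d c / (a * rc_hbar c + (1 - a) * rc_h c)
  | Model2 => rc_d c / (a ^+ 2 * rc_hbar c + (1 - a ^+ 2) * rc_h c)
  end.

(* At x = y = 0 the quotient is 0: division by zero yields 0, so the autonomy
   level is 0, the capacity is d / h, and 0 / (d / h) = 0. *)
Definition latency {R : realType} (c : road_cost R) (x y : R) : R :=
  rc_t c * (1 + rc_rho c * ((x + y) / capacity c x y) `^ rc_sigma c).

Definition asymmetry {R : realType} (c : road_cost R) : R :=
  Num.max (rc_h c / rc_hbar c) (rc_hbar c / rc_h c).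

(* Roads are indexed rather than given by a relation on nodes, so parallel
   roads are allowed. *)
Record game (R : realType) := Game {
  node : finType;
  nroad : nat;
  npair : nat;
  road_tail : 'I_nroad -> node;
  road_head : 'I_nroad -> node;
  orig : 'I_npair -> node;
  dest : 'I_npair -> node;
  human_demand : 'I_npair -> R;
  auto_demand : 'I_npair -> R;
  road : 'I_nroad -> road_cost R;
  human_demand_ge0 : forall j, 0 <= human_demand j;
  auto_demand_ge0 : forall j, 0 <= auto_demand j
}.
Arguments road_tail {R} g _.
Arguments road_head {R} g _.
Arguments orig {R} g _.
Arguments dest {R} g _.
Arguments human_demand {R} g _.
Arguments auto_demand {R} g _.
Arguments road {R} g _.

(* Each maximum is over positive numbers, so the unit 0 is neutral as soon as
   there is a road. *)
Definition max_asymmetry {R : realType} (G : game R) : R :=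
  \big[Num.max/0]_(i < nroad G) asymmetry (road G i).

Definition max_degree {R : realType} (G : game R) : R :=
  \big[Num.max/0]_(i < nroad G) rc_sigma (road G i).

Definition in_class {R : realType} (k sigma : R) (G : game R) : Prop :=
  max_asymmetry G = k /\ max_degree G = sigma.

Fixpoint is_walk {R : realType} (G : game R) (u : node G)
    (p : seq 'I_(nroad G)) (v : node G) : bool :=
  if p is i :: p' then (road_tail G i == u) && is_walk (road_head G i) p' v
  else u == v.

Definition is_path {R : realType} (G : game R) (u : node G)
    (p : seq 'I_(nroad G)) (v : node G) : bool :=
  is_walk u p v && uniq (u :: map (road_head G) p).

(* A path that visits no node twice uses no road twice, so it has at most
   [nroad G] roads: the bound on the length excludes no path. *)
Definition paths {R : realType} (G : game R) (j : 'I_(npair G)) :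
    {set (nroad G).-bseq 'I_(nroad G)} :=
  [set p : (nroad G).-bseq 'I_(nroad G) | is_path (orig G j) p (dest G j)].

(* The amount of flow (of one vehicle type) that each origin-destination pair
   sends on each path; only the values at [p \in paths j] matter. *)
Definition path_flow {R : realType} (G : game R) : Type :=
  'I_(npair G) -> (nroad G).-bseq 'I_(nroad G) -> R.

Definition routes_demand {R : realType} (G : game R)
    (demand : 'I_(npair G) -> R) (f : path_flow G) : Prop :=
  (forall j p, p \in paths j -> 0 <= f j p) /\
  (forall j, \sum_(p in paths j) f j p = demand j).

Definition road_flow {R : realType} (G : game R) (f : path_flow G)
    (i : 'I_(nroad G)) : R :=
  \sum_(j < npair G) \sum_(p in paths j | i \in p) f j p.

(* [z i] is the pair (x_i, y_i) of human-driven and autonomous flows. *)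
Definition routing {R : realType} (G : game R) : Type :=
  'I_(nroad G) -> R * R.

Definition induces {R : realType} (G : game R) (f g : path_flow G)
    (z : routing G) : Prop :=
  [/\ routes_demand (human_demand G) f,
      routes_demand (auto_demand G) g
    & forall i, z i = (road_flow f i, road_flow g i)].

(* Flow conservation is built into the decomposition along paths. *)
Definition feasible {R : realType} (G : game R) (z : routing G) : Prop :=
  exists f g : path_flow G, induces f g z.

Definition road_latency {R : realType} (G : game R) (z : routing G)
    (i : 'I_(nroad G)) : R :=
  latency (road G i) (z i).1 (z i).2.

Definition path_latency {R : realType} (G : game R) (z : routing G)
    (p : seq 'I_(nroad G)) : R :=
  \sum_(i <- p) road_latency z i.

Definition social_cost {R : realType} (G : game R) (z : routing G) : R :=
  \sum_(i < nroad G) road_latency z i * ((z i).1 + (z i).2).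

Definition used {R : realType} (G : game R) (f g : path_flow G)
    (j : 'I_(npair G)) (p : (nroad G).-bseq 'I_(nroad G)) : Prop :=
  p \in paths j /\ (0 < f j p \/ 0 < g j p).

Definition equilibrium {R : realType} (G : game R) (z : routing G) : Prop :=
  exists f g : path_flow G,
    [/\ induces f g z,
        forall j p q, used f g j p -> used f g j q ->
          path_latency z p = path_latency z q
      & forall j p q, used f g j p -> q \in paths j -> ~ used f g j q ->
          path_latency z p <= path_latency z q].

Definition worst_equilibrium {R : realType} (G : game R) (z : routing G) :
    Prop :=
  equilibrium z /\
  forall z' : routing G, equilibrium z' -> social_cost z' <= social_cost z.

Definition social_optimum {R : realType} (G : game R) (z : routing G) : Prop :=
  feasible z /\
  forall z' : routing G, feasible z' -> social_cost z <= social_cost z'.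

(* [r] is the price of anarchy of [G]; a game whose optimal social cost is 0
   has none, the ratio being undefined. *)
Definition is_price_of_anarchy {R : realType} (G : game R) (r : R) : Prop :=
  exists zeq zopt : routing G,
    [/\ worst_equilibrium zeq, social_optimum zopt, 0 < social_cost zopt
      & r = social_cost zeq / social_cost zopt].

Definition sup_price_of_anarchy {R : realType} (k sigma : R) : \bar R :=
  ereal_sup [set r%:E | r in
    [set r : R | exists G : game R, in_class k sigma G /\
                                    is_price_of_anarchy G r]]%classic.

Definition xi {R : realType} (sigma : R) : R :=
  sigma * (sigma + 1) `^ (- ((sigma + 1) / sigma)).

Definition poa_bound {R : realType} (k sigma : R) : R :=
  k `^ sigma / (1 - xi sigma).

(* Main.v *)
Require Import Defs.
From HB Require Import structures.
From mathcomp Require Import all_boot all_order all_algebra.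
From mathcomp Require Import all_classical all_reals all_analysis.
From mathcomp Require Import ring lra.
Import Order.TTheory GRing.Theory Num.Theory.
Local Open Scope ring_scope.

(** The bound is attained up to a constant by swapping the two vehicle types
    on two parallel roads.  On one road a human-driven vehicle occupies [k]
    times the space of an autonomous one, on the other the spacings are
    exchanged; each type has demand [1] and the latency is
    [1 + (occupied space) ^ sigma].

    If each type takes the road where it is short, both roads carry load [1]
    and the social cost is [4].  This is optimal: a flow [s] occupies at least
    the space [s], so the cost is at least
    [2 + s ^ (sigma + 1) + (2 - s) ^ (sigma + 1)], and by convexity of the
    power function this is at least [4] ([swap_optimum]).

    If each type takes the road where it is long, both roads have latency
    [1 + k ^ sigma], so nobody gains by switching, and the social cost is
    [2 (1 + k ^ sigma)].  No equilibrium is worse: the road with more vehicles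
    would also be the slower one, so in equilibrium each road has total flow
    [1], hence load at most [k] ([swap_worst_equilibrium]).

    The price of anarchy of this game is therefore [(1 + k ^ sigma) / 2], and
    since [xi sigma < 1] the constant [(1 - xi sigma) / 2] witnesses
    order-optimality. *)

(** * Parallel networks *)

Section Parallel.
Context {R : realType} {n : nat} (c : 'I_n.+1 -> road_cost R) {a b : R}.
Hypotheses (a_ge0 : 0 <= a) (b_ge0 : 0 <= b).

Definition parallel : game R :=
  {| node := bool;
     npair := 1;
     road_tail := fun _ : 'I_n.+1 => false;
     road_head := fun _ => true;
     orig := fun _ => false;
     dest := fun _ => true;
     human_demand := fun _ => a;
     auto_demand := fun _ => b;
     road := c;
     human_demand_ge0 := fun _ => a_ge0;
     auto_demand_ge0 := fun _ => b_ge0 |}.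

Definition road_path (i : 'I_n.+1) : n.+1.-bseq 'I_n.+1 :=
  @Bseq n.+1 _ [:: i] isT.

Lemma road_path_inj : injective road_path.
Proof. by move=> i j /(congr1 val) [->]. Qed.

Lemma mem_road_path (i j : 'I_n.+1) : (j \in road_path i) = (j == i).
Proof. by rewrite -[LHS]/(j \in [:: i]) inE. Qed.

(** All roads lead from the origin to the destination and none leaves the
    destination, so a path consists of exactly one road. *)
Lemma parallel_paths (j : 'I_1) :
  @paths R parallel j = [set road_path i | i : 'I_n.+1].
Proof.
apply/setP => p; rewrite inE; apply/idP/imsetP => [|[i _ ->] //].
case: p => [[|i [|i' p]] sz] //= _.
by exists i => //; apply: val_inj.
Qed.

Lemma sum_parallel_paths (j : 'I_1) (F : n.+1.-bseq 'I_n.+1 -> R) :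
  \sum_(p in @paths R parallel j) F p = \sum_i F (road_path i).
Proof.
rewrite parallel_paths big_imset //=.
by move=> i i' _ _; apply: road_path_inj.
Qed.

Lemma parallel_road_flow (f : path_flow parallel) (i : 'I_n.+1) :
  road_flow f i = f ord0 (road_path i).
Proof.
rewrite /road_flow /= big_ord1 big_mkcondr sum_parallel_paths.
rewrite (bigD1 i) //= mem_road_path eqxx big1 ?addr0 // => i' ne.
by rewrite mem_road_path eq_sym (negbTE ne).
Qed.

(** A path determines its only road, so road flows are path flows; the default
    [ord0] of [head] is reached only on the empty sequence, not a path here. *)
Definition of_road_flow (w : 'I_n.+1 -> R) : path_flow parallel :=
  fun _ p => w (head ord0 p).

Lemma routes_of_road_flow (w : 'I_n.+1 -> R) (e : R) :
  (forall i, 0 <= w i) -> \sum_i w i = e ->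
  @routes_demand R parallel (fun _ => e) (of_road_flow w).
Proof.
by move=> w0 we; split=> [j p _|j]; [apply: w0 | rewrite sum_parallel_paths].
Qed.

Lemma parallel_routes (f : path_flow parallel) (e : R) :
  @routes_demand R parallel (fun _ => e) f ->
  (forall i, 0 <= road_flow f i) /\ \sum_i road_flow f i = e.
Proof.
move=> [f0 fe]; split=> [i|].
  by rewrite parallel_road_flow; apply: f0; rewrite parallel_paths imset_f.
rewrite -[RHS](fe ord0) sum_parallel_paths.
by apply: eq_bigr => i _; rewrite parallel_road_flow.
Qed.

Definition splits_demand (z : routing parallel) : Prop :=
  [/\ forall i, 0 <= (z i).1, forall i, 0 <= (z i).2,
      \sum_i (z i).1 = a & \sum_i (z i).2 = b].

Lemma splits_demand_induces (z : routing parallel) : splits_demand z ->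
  induces (of_road_flow (fun i => (z i).1)) (of_road_flow (fun i => (z i).2)) z.
Proof.
case=> x0 y0 xa yb; split; [exact: routes_of_road_flow..|].
by move=> i; rewrite !parallel_road_flow -surjective_pairing.
Qed.

Lemma induces_splits_demand (f g : path_flow parallel) (z : routing parallel) :
  induces f g z -> splits_demand z.
Proof.
case=> /parallel_routes[f0 fa] /parallel_routes[g0 gb] zE.
split=> [i|i||]; rewrite ?zE //=.
- by rewrite -fa; apply: eq_bigr => i _; rewrite zE.
- by rewrite -gb; apply: eq_bigr => i _; rewrite zE.
Qed.

(** Paths and path flows disappear: feasibility becomes a condition on the
    flows of the single roads. *)
Lemma parallel_feasibleP (z : routing parallel) :
  feasible z <-> splits_demand z.
Proof.
split=> [[f [g]]|zs]; first exact: induces_splits_demand.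
by do 2 eexists; apply: splits_demand_induces.
Qed.

(** The two conditions of an equilibrium, on used and on unused alternatives,
    merge into one: no road is faster than a road that carries vehicles.  This
    turns equilibria into inequalities between road flows. *)
Lemma parallel_equilibriumP (z : routing parallel) :
  equilibrium z <->
  splits_demand z /\
  forall i j, 0 < (z i).1 + (z i).2 -> road_latency z i <= road_latency z j.
Proof.
have plE i : path_latency z (road_path i) = road_latency z i.
  by rewrite /path_latency big_seq1.
split=> [[f [g [ind same less]]]|[zs le_lat]].
  have zs := induces_splits_demand _ _ _ ind.
  split=> // i j zi; case: ind => _ _ zE.
  have usedi : used f g ord0 (road_path i).
    split; first by rewrite parallel_paths imset_f.
    move: zi; rewrite zE /= !parallel_road_flow => zi.
    apply/orP; apply: contraTT zi; rewrite negb_or -!leNgt => /andP[fi gi].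
    lra.
  rewrite -!plE.
  have [usedj|nusedj] := pselect (used f g ord0 (road_path j)).
    by rewrite (same _ _ _ usedi usedj).
  by apply: less usedi _ nusedj; rewrite parallel_paths imset_f.
have used_lat j p q : used (of_road_flow (fun i => (z i).1))
    (of_road_flow (fun i => (z i).2)) j p -> q \in @paths R parallel j ->
    path_latency z p <= path_latency z q.
  rewrite /used parallel_paths => -[/imsetP[i _ ->]] pos /imsetP[i' _ ->].
  rewrite !plE; apply: le_lat; case: zs => x0 y0 _ _.
  by case: pos => pos; [apply: ltr_pwDl|apply: ltr_wpDl].
exists (of_road_flow (fun i => (z i).1)), (of_road_flow (fun i => (z i).2)).
split; first exact: splits_demand_induces.
- move=> j p q up uq; apply: le_anti; apply/andP; split.
    by apply: used_lat up (proj1 uq).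
  by apply: used_lat uq (proj1 up).
- by move=> j p q up qin _; apply: used_lat up qin.
Qed.

End Parallel.

(** * Latency in terms of occupied space *)

(** Multiplying the average spacing by the number of vehicles gives the space
    the flows occupy, so under the first capacity model congestion depends on
    a linear form; this includes the empty road, which has no congestion. *)
Lemma latency_model1 {R : realType} (c : road_cost R) (x y : R) :
  rc_model c = Model1 -> 0 <= x -> 0 <= y ->
  latency c x y = rc_t c *
    (1 + rc_rho c * ((rc_h c * x + rc_hbar c * y) / rc_d c) `^ rc_sigma c).
Proof.
move=> mE x0 y0; rewrite /latency /capacity mE /autonomy.
congr (_ * (1 + _ * _ `^ _)); rewrite invf_div mulrA; congr (_ / _).
have [xy0|xyn0] := eqVneq (x + y) 0; last by field.
have -> : x = 0 by lra.
have -> : y = 0 by lra.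
by ring.
Qed.

(** * Power sums with a fixed total *)

Lemma sum_powR_ge2 {R : realType} (p s : R) : 1 <= p -> 0 <= s <= 2 ->
  2 <= s `^ p + (2 - s) `^ p.
Proof.
move=> p1 /andP[s0 s2].
have [half0 half1] : 0 <= (2^-1 : R) /\ (2^-1 : R) <= 1 by lra.
(* midpoint convexity at [s] and [2 - s] *)
have : (2^-1 * s + (1 - 2^-1) * (2 - s)) `^ p <=
       2^-1 * s `^ p + (1 - 2^-1) * (2 - s) `^ p.
  apply: (convex_powR p1 (Itv01 half0 half1)); rewrite inE /= in_itv /= andbT //.
  by rewrite subr_ge0.
have -> : 2^-1 * s + (1 - 2^-1) * (2 - s) = 1 by field.
rewrite powR1; lra.
Qed.

(** * The swapped-spacing game *)

Section Swap.
Context {R : realType} {k sigma : R}.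
Hypotheses (k_ge1 : 1 <= k) (sigma_ge1 : 1 <= sigma).

Let k_gt0 : 0 < k. Proof. exact: lt_le_trans ltr01 k_ge1. Qed.

Definition long_human : road_cost R :=
  @RoadCost R 1 1 sigma Model1 1 k 1
    ler01 ler01 sigma_ge1 ltr01 k_gt0 ltr01.

Definition long_auto : road_cost R :=
  @RoadCost R 1 1 sigma Model1 1 1 k
    ler01 ler01 sigma_ge1 ltr01 ltr01 k_gt0.

Definition swap_game : game R :=
  parallel (fun i : 'I_2 => if i == ord0 then long_human else long_auto)
    (@ler01 R) (@ler01 R).

Lemma swap_in_class : in_class k sigma swap_game.
Proof.
have k1 : k^-1 <= k by rewrite (le_trans _ k_ge1) // invf_le1.
rewrite /in_class /max_asymmetry /max_degree /swap_game /=.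
split; rewrite !big_ord_recl big_ord0 /=.
  rewrite /asymmetry /= divr1 div1r (max_l k1) (max_r k1).
  by rewrite (max_l (ltW k_gt0)) maxxx.
by rewrite (max_l (le_trans ler01 sigma_ge1)) maxxx.
Qed.

Lemma swap_latency (z : routing swap_game) :
    (forall i, 0 <= (z i).1) -> (forall i, 0 <= (z i).2) ->
  road_latency z ord0 = 1 + (k * (z ord0).1 + (z ord0).2) `^ sigma /\
  road_latency z ord_max = 1 + ((z ord_max).1 + k * (z ord_max).2) `^ sigma.
Proof.
move=> x0 y0; rewrite /road_latency !latency_model1 //=.
by rewrite !mul1r !divr1.
Qed.

(** [route x y] sends [x] humans and [y] autonomous vehicles on the road where
    humans are long. *)
Definition route (x y : R) : routing swap_game :=
  fun i => if i == ord0 then (x, y) else (1 - x, 1 - y).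

Lemma swap_split (z : routing swap_game) : splits_demand _ _ _ z ->
  [/\ 0 <= (z ord0).1 <= 1, 0 <= (z ord0).2 <= 1,
      (z ord_max).1 = 1 - (z ord0).1 & (z ord_max).2 = 1 - (z ord0).2].
Proof.
case=> x0 y0; rewrite !big_ord_recl !big_ord0 /= !addr0.
have -> : lift ord0 ord0 = ord_max :> 'I_2 by apply: val_inj.
have := x0 ord0; have := x0 ord_max; have := y0 ord0; have := y0 ord_max.
move: (z ord0).1 (z ord0).2 (z ord_max).1 (z ord_max).2.
move=> x y x' y' ? ? ? ? ? ?.
by split; lra.
Qed.

Lemma social_cost_swap (z : routing swap_game) : social_cost z =
  road_latency z ord0 * ((z ord0).1 + (z ord0).2) +
  road_latency z ord_max * ((z ord_max).1 + (z ord_max).2).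
Proof.
rewrite /social_cost /swap_game /= !big_ord_recl big_ord0 /= addr0.
by have -> : lift ord0 ord0 = ord_max :> 'I_2 by apply: val_inj.
Qed.

Lemma route_split (x y : R) : 0 <= x <= 1 -> 0 <= y <= 1 ->
  splits_demand _ _ _ (route x y).
Proof.
move=> hx hy; rewrite /route; split.
- by move=> i; case: ifP => _ /=; lra.
- by move=> i; case: ifP => _ /=; lra.
- by rewrite !big_ord_recl big_ord0 /=; lra.
- by rewrite !big_ord_recl big_ord0 /=; lra.
Qed.

Lemma ord2P (P : 'I_2 -> Prop) : P ord0 -> P ord_max -> forall i, P i.
Proof.
move=> P0 P1 [[|[|//]] i2].
  by have -> : Ordinal i2 = ord0 by apply: val_inj.
by have -> : Ordinal i2 = ord_max by apply: val_inj.
Qed.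

Lemma swap_equilibrium : equilibrium (route 1 0).
Proof.
apply/parallel_equilibriumP.
have zs : splits_demand _ _ _ (route 1 0) by apply: route_split; lra.
split=> //; case: zs => x0 y0 _ _.
have [] := swap_latency _ x0 y0; rewrite /= subrr subr0 mulr1 addr0 add0r.
by move=> L0 L1; apply: ord2P; apply: ord2P => _; rewrite ?L0 ?L1.
Qed.

Lemma swap_equilibrium_cost : social_cost (route 1 0) = 2 * (1 + k `^ sigma).
Proof.
have [x0 y0 _ _] : splits_demand _ _ _ (route 1 0) by apply: route_split; lra.
rewrite social_cost_swap; have [-> ->] := swap_latency _ x0 y0.
rewrite /= subrr subr0 mulr1 addr0 add0r; lra.
Qed.

(** The loads of the two roads differ by [k + 1] times the excess over [1] of
    the total flow on the first road.  If the total flows were different, the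
    road with more vehicles would therefore be used and strictly slower than
    the other one. *)
Lemma swap_equilibrium_balanced (z : routing swap_game) :
  equilibrium z -> (z ord0).1 + (z ord0).2 = 1.
Proof.
move=> /parallel_equilibriumP[zs le_lat].
have [hx hy x'E y'E] := swap_split _ zs.
case: zs => x0 y0 _ _; have [L0 L1] := swap_latency _ x0 y0.
have [k1 s1] := (k_ge1, sigma_ge1).
have := le_lat ord0 ord_max; have := le_lat ord_max ord0.
rewrite L0 L1 x'E y'E !lerD2l.
move: (z ord0).1 (z ord0).2 hx hy => x y hx hy.
have pow_lt (u v : R) : 0 <= u -> u < v -> u `^ sigma < v `^ sigma.
  move=> u0 uv; have v0 := le_trans u0 (ltW uv).
  by apply: gt0_ltr_powR => //; lra.
have load_ge0 (u v : R) : 0 <= u -> 0 <= v -> 0 <= k * u + v.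
  by move=> u0 v0; apply: addr_ge0 => //; apply/mulr_ge0/u0/ltW.
move=> H1 H0; apply: le_anti; apply/andP; split; rewrite leNgt; apply/negP => h.
- have gap : 0 < (k + 1) * (x + y - 1) by apply: mulr_gt0; lra.
  have : (1 - x + k * (1 - y)) `^ sigma < (k * x + y) `^ sigma.
    by apply: pow_lt; [rewrite addrC; apply: load_ge0; lra | lra].
  by rewrite ltNge H0 //; lra.
- have gap : 0 < (k + 1) * (1 - (x + y)) by apply: mulr_gt0; lra.
  have : (k * x + y) `^ sigma < (1 - x + k * (1 - y)) `^ sigma.
    by apply: pow_lt; [apply: load_ge0; lra | lra].
  by rewrite ltNge H1 //; lra.
Qed.

Lemma swap_worst_equilibrium : worst_equilibrium (route 1 0).
Proof.
split=> [|z eqz]; first exact: swap_equilibrium.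
have bal := swap_equilibrium_balanced _ eqz.
move: eqz => /parallel_equilibriumP[zs _].
have [hx hy x'E y'E] := swap_split _ zs.
case: zs => x0 y0 _ _; rewrite swap_equilibrium_cost social_cost_swap.
have [-> ->] := swap_latency _ x0 y0; rewrite x'E y'E.
move: (z ord0).1 (z ord0).2 hx hy bal => x y hx hy bal.
have [k1 s1] := (k_ge1, sigma_ge1).
have pow_le (u : R) : 0 <= u <= k -> u `^ sigma <= k `^ sigma.
  by move=> /andP[u0 uk]; apply: ge0_ler_powR; rewrite ?nnegrE //; lra.
have [p1 p2] : 0 <= (k - 1) * x /\ 0 <= (k - 1) * (1 - x).
  by split; apply: mulr_ge0; lra.
have h0 : (k * x + y) `^ sigma <= k `^ sigma.
  by apply: pow_le; have -> : y = 1 - x by [lra]; apply/andP; split; lra.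
have h1 : (1 - x + k * (1 - y)) `^ sigma <= k `^ sigma.
  by apply: pow_le; have -> : y = 1 - x by [lra]; apply/andP; split; lra.
have -> : 1 - x + (1 - y) = 1 by lra.
rewrite bal; lra.
Qed.

Lemma swap_optimum_cost : social_cost (route 0 1) = 4.
Proof.
have [x0 y0 _ _] : splits_demand _ _ _ (route 0 1) by apply: route_split; lra.
rewrite social_cost_swap; have [-> ->] := swap_latency _ x0 y0.
rewrite /= subrr subr0 !mulr0 addr0 add0r powR1; lra.
Qed.

(** As [k >= 1], a road carrying flow [s] has load at least [s], so the
    congestion part of the cost dominates the power sum
    [s ^ (sigma + 1) + (2 - s) ^ (sigma + 1)]. *)
Lemma swap_optimum : social_optimum (route 0 1).
Proof.
split=> [|z /parallel_feasibleP zs].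
  by apply/parallel_feasibleP; apply: route_split; lra.
have [hx hy x'E y'E] := swap_split _ zs.
case: zs => x0 y0 _ _; rewrite swap_optimum_cost social_cost_swap.
have [-> ->] := swap_latency _ x0 y0; rewrite x'E y'E.
move: (z ord0).1 (z ord0).2 hx hy => x y hx hy.
have [k1 s1] := (k_ge1, sigma_ge1).
have cost_ge (u v : R) : 0 <= u -> u <= v -> u `^ (sigma + 1) <= v `^ sigma * u.
  move=> u0 uv; rewrite powRD; last by apply/implyP => /eqP; lra.
  rewrite powRr1 //; apply: ler_wpM2r => //.
  by apply: ge0_ler_powR; rewrite ?nnegrE //; lra.
have k_ge (u : R) : 0 <= u -> u <= k * u by move=> u0; rewrite ler_peMl.
have kx : x <= k * x by apply: k_ge; lra.
have ky : 1 - y <= k * (1 - y) by apply: k_ge; lra.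
have h1 : (x + y) `^ (sigma + 1) <= (k * x + y) `^ sigma * (x + y).
  by apply: cost_ge; lra.
have h2 : (2 - (x + y)) `^ (sigma + 1) <=
    (1 - x + k * (1 - y)) `^ sigma * (2 - (x + y)).
  by apply: cost_ge; lra.
have : 2 <= (x + y) `^ (sigma + 1) + (2 - (x + y)) `^ (sigma + 1).
  by apply: sum_powR_ge2; lra.
have -> : 1 - x + (1 - y) = 2 - (x + y) by ring.
rewrite !mulrDl !mul1r; lra.
Qed.

Lemma swap_price_of_anarchy :
  is_price_of_anarchy swap_game ((1 + k `^ sigma) / 2).
Proof.
exists (route 1 0), (route 0 1).
rewrite swap_equilibrium_cost swap_optimum_cost; split=> //.
- exact: swap_worst_equilibrium.
- exact: swap_optimum.
- by field.
Qed.

End Swap.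

(** * Order-optimality *)

(** The exponent [(sigma + 1) / sigma] exceeds [1], so
    [xi sigma <= sigma / (sigma + 1)]. *)
Lemma xi_lt1 {R : realType} (sigma : R) : 1 <= sigma -> xi sigma < 1.
Proof.
move=> s1; rewrite /xi powRN.
have s10 : 0 < sigma + 1 by lra.
have pow_ge : sigma + 1 <= (sigma + 1) `^ ((sigma + 1) / sigma).
  apply: le1r_powR; first lra.
  by rewrite ler_pdivlMr; lra.
rewrite ltr_pdivrMr ?mul1r; lra.
Qed.

Theorem corollary1 (R : realType) (sigma : R) (hsigma : 1 <= sigma) :
  exists a : R, 0 < a /\
    forall k : R, 1 <= k ->
      ((a * poa_bound k sigma)%:E <= sup_price_of_anarchy k sigma)%E.
Proof.
have xi1 := xi_lt1 _ hsigma.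
exists ((1 - xi sigma) / 2); split; first by rewrite divr_gt0 // subr_gt0.
move=> k k1; apply: (@le_trans _ _ ((1 + k `^ sigma) / 2)%:E).
  rewrite lee_fin /poa_bound.
  have -> : (1 - xi sigma) / 2 * (k `^ sigma / (1 - xi sigma)) = k `^ sigma / 2.
    by field; rewrite subr_eq0 gt_eqF.
  lra.
apply: ereal_sup_ubound; exists ((1 + k `^ sigma) / 2) => //.
exists (swap_game k1 hsigma); split.
  exact: swap_in_class.
exact: swap_price_of_anarchy.
Qed.
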